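(* Let $X$ be a finite set with $|X|\geq 2$, put $p=2|X|-1$, and let $y$ be the exponential growth rate of the free inverse monoid $\mathrm{FIM}(X)$. Then $y$ is the largest real root of the polynomial equation \[p^p y^{p-2}-(py-1)^{p-1}=0,\] and $y\in(p,p+1)$. In particular, $y$ is an algebraic number.
   Context: $\mathrm{FIM}(X)$ is the free inverse monoid on $X$, generated as a monoid by $X\cup X^{-1}$, where $X^{-1}$ is a disjoint copy of $X$. The length of an element is the minimal length of a word over $X\cup X^{-1}$ representing it. $S(K)$ is the set of elements of length exactly $K$. The exponential growth rate is $\limsup_{K\to\infty}|S(K)|^{1/K}$. *)

(* Defs.v *)
From HB Require Import structures.
From mathcomp Require Import all_boot all_order all_algebra.
From mathcomp Require Import all_classical all_reals all_analysis.
Set Implicit Arguments. Unset Strict Implicit. Unset Printing Implicit Defensive.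
Import Order.TTheory GRing.Theory Num.Theory.

(* Letters of X ∪ X^{-1}: inl x stands for x, inr x for x^{-1}. *)
Definition letter (X : Type) := (X + X)%type.

Definition inv_letter (X : Type) (a : letter X) : letter X :=
  match a with inl x => inr x | inr x => inl x end.

Definition inv_word (X : Type) (w : seq (letter X)) : seq (letter X) :=
  rev (map (@inv_letter X) w).

(* The Vagner congruence: the smallest congruence on (X ∪ X^{-1})^* containing
   u u^{-1} u = u and u u^{-1} v v^{-1} = v v^{-1} u u^{-1}.  The free inverse
   monoid FIM(X) is the quotient of (X ∪ X^{-1})^* by this congruence. *)
Inductive fim_eq (X : Type) : seq (letter X) -> seq (letter X) -> Prop :=
| fim_refl w : fim_eq w w
| fim_sym w1 w2 : fim_eq w1 w2 -> fim_eq w2 w1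
| fim_trans w1 w2 w3 : fim_eq w1 w2 -> fim_eq w2 w3 -> fim_eq w1 w3
| fim_cat a b c d : fim_eq a b -> fim_eq c d -> fim_eq (a ++ c) (b ++ d)
| fim_red u : fim_eq (u ++ inv_word u ++ u) u
| fim_comm u v : fim_eq (u ++ inv_word u ++ v ++ inv_word v)
                        (v ++ inv_word v ++ u ++ inv_word u).

Definition fim_geodesic (X : Type) (w : seq (letter X)) : Prop :=
  forall w' : seq (letter X), fim_eq w w' -> size w <= size w'.

(* |S(K)|: number of elements of FIM(X) of length exactly K, i.e. the number
   of distinct congruence classes having a geodesic representative of size K.
   A class is identified by its set of representatives of size K. *)
Definition fim_sphere_card (X : finType) (K : nat) : nat :=
  #|[set [set w' : K.-tuple (letter X) | `[< fim_eq (tval w) (tval w') >]]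
     | w in [set w : K.-tuple (letter X) | `[< fim_geodesic (tval w) >]]]|.

Definition fim_growth_rate (R : realType) (X : finType) : \bar R :=
  limn_esup (fun K : nat => (((fim_sphere_card X K)%:R : R) `^ (K%:R^-1))%:E).

(* Main.v *)
Require Import Defs.
From HB Require Import structures.
From mathcomp Require Import all_boot all_order all_algebra.
From mathcomp Require Import all_classical all_reals all_analysis.
From mathcomp Require Import zify ring lra.
From Stdlib Require Setoid.
Set Implicit Arguments. Unset Strict Implicit. Unset Printing Implicit Defensive.
Import Order.TTheory GRing.Theory Num.Theory.

(* An element of FIM(X) is a Munn tree: a finite subtree of the Cayley graph of
   the free group containing 1, with a marked vertex g.  A shortest word for it
   walks along the trunk from 1 to g and, at every trunk vertex, traverses depth
   first the bushes hanging there; a bush edge is read twice, a trunk edge once.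
   If C(x) = 1 + x C(x)^p counts bushes through a given letter by edges, a trunk
   of length m >= 1 contributes (p+1) z C^(2p) (p z C^(p-1))^(m-1) with
   C = C(z^2).  Hence the sphere series diverges exactly from the z with
   p z C(z^2)^(p-1) = 1 on; there C = p/(p-z), and z = 1/y gives the equation
   p^p y^(p-2) = (py-1)^(p-1). *)

(** The congruence is given only by generators, so counting its classes needs a normal form whose
    length is under control. Prepending one letter to a canonical word can be repaired at the cost
    of at most one letter; hence every word is congruent to a canonical word that is no longer.
    Conversely, the endpoint and the set of visited vertices are invariants, and they determine a
    canonical word. The two facts together make canonical words geodesic and give exactly one per
    element.

    Bushes at a vertex may be traversed in any order. Fixing the enumeration order of the letters
    makes the word unique, and the price is that bushes must be moved past each other, which is
    commutation of idempotents.

    Bounding the height of bushes by [h] turns generating series into finite sums, meaningful at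
    every real z. Below the critical point they are bounded uniformly in [h]; above it, one fixed
    height with long trunks already has unbounded weight. Finite heights suffice there because at
    the critical z the iteration defining C(z^2) has slope z < 1 at its fixed point: trunks diverge
    before bushes do. *)

Section CanonicalWords.
Variable X : finType.
Local Notation L := (letter X).
Implicit Types (a b : L) (u v w e c : seq L) (s : seq L) (o : option L).
Implicit Types (h m : nat).
Local Notation inv := (@inv_letter X).
Local Notation "u ~~~ v" := (fim_eq u v) (at level 70).

#[local] Hint Resolve fim_refl : core.

(** * Idempotents of the Vagner congruence, and canonical words *)

Lemma inv_letterK : involutive inv.
Proof. by case. Qed.

Lemma inv_word_cat u v : inv_word (u ++ v) = inv_word v ++ inv_word u.
Proof. by rewrite /inv_word map_cat rev_cat. Qed.

Lemma inv_word_cons a u : inv_word (a :: u) = inv_word u ++ [:: inv a].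
Proof. by rewrite /inv_word /= rev_cons cats1. Qed.

Lemma inv_wordK : involutive (@inv_word X).
Proof. by move=> u; rewrite /inv_word map_rev revK (mapK inv_letterK). Qed.

#[local] Instance fim_equiv : RelationClasses.Equivalence (@fim_eq X).
Proof.
by split; [exact: fim_refl | exact: fim_sym | move=> ? ? ?; exact: fim_trans].
Qed.

#[local] Instance fim_cat_proper :
  Morphisms.Proper (Morphisms.respectful (@fim_eq X)
    (Morphisms.respectful (@fim_eq X) (@fim_eq X))) (@cat L).
Proof. by move=> a b ab c d cd; exact: fim_cat. Qed.

#[local] Instance fim_cons_proper a : 
  Morphisms.Proper (Morphisms.respectful (@fim_eq X) (@fim_eq X)) (@cons L a).
Proof. by move=> u v uv; apply: (@fim_cat _ [:: a] [:: a]) => //; exact: fim_refl. Qed.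

(** In an inverse monoid the idempotents are exactly the elements v v^{-1}; this form matches the
    commutation relation directly. *)
Definition fim_idem u := exists v, u ~~~ v ++ inv_word v.

Lemma fim_idem_nil : fim_idem [::].
Proof. by exists [::]; exact: fim_refl. Qed.

Lemma fim_idem_comm u v : fim_idem u -> fim_idem v -> u ++ v ~~~ v ++ u.
Proof.
by move=> [u' ->] [v' ->]; have := fim_comm u' v'; rewrite -!catA.
Qed.

Lemma fim_idem_cat u v : fim_idem u -> fim_idem v -> fim_idem (u ++ v).
Proof.
move=> iu iv; have comm := fim_idem_comm iu iv.
(* For this witness x, the product x x^{-1} is u v u, which commutation and u u = u collapse to u
   v. *)
case: iu iv comm => u' eu [v' ev] comm; exists (u' ++ inv_word u' ++ v').
have uu : u ++ u ~~~ u .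
  transitivity ((u' ++ inv_word u' ++ u') ++ inv_word u').
    by rewrite eu -!catA.
  by rewrite (fim_red u') eu.
transitivity (u ++ v ++ u); first by rewrite -comm catA uu.
by rewrite eu ev !inv_word_cat inv_wordK -!catA.
Qed.

Lemma fim_idem_conj a u : fim_idem u -> fim_idem (a :: u ++ [:: inv a]).
Proof.
move=> [v eu]; exists (a :: v); rewrite inv_word_cons eu -catA.
exact: fim_refl.
Qed.

(* Letters along which a reduced path may continue after the incoming letter o
   (None at the root of the Munn tree). *)
Definition slots o := [seq b <- enum {: L} | o != Some (inv b)].

Lemma slots_uniq o : uniq (slots o).
Proof. by rewrite filter_uniq ?enum_uniq. Qed.

Lemma mem_slots o b : (b \in slots o) = (o != Some (inv b)).
Proof. by rewrite mem_filter mem_enum andbT. Qed.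

Lemma slots_Some a : slots (Some a) = rem (inv a) (slots None).
Proof.
rewrite rem_filter ?slots_uniq // /slots -[RHS]filter_predI; apply: eq_filter => b /=.
by rewrite andbT (inj_eq Some_inj) -(inj_eq (inv_inj inv_letterK)) inv_letterK eq_sym.
Qed.

(** The order of [s] is kept, so one choice of bush per letter yields one word. The family [E] is a
    parameter because [excursions] recurses through this function. *)
Definition concat_words (E : L -> seq (seq L)) s : seq (seq L) :=
  foldr (fun a U => [seq e ++ u | e <- E a, u <- U]) [:: [::]] s.

(* Canonical words of the trees of height at most h hanging off a vertex through
   the edge labelled a, the empty tree included. *)
Fixpoint excursions h a : seq (seq L) :=
  if h is h'.+1 then
    [::] :: [seq a :: u ++ [:: inv a]
            | u <- concat_words (excursions h') (slots (Some a))]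
  else [:: [::]].

Definition bushes h s := concat_words (excursions h) s.

(* m is the length of the trunk, h bounds the height of the bushes, and o is the
   letter through which the first trunk vertex was entered. *)
Fixpoint canon_words h m o : seq (seq L) :=
  if m is m'.+1 then
    [seq uv.1 ++ b :: uv.2 | b <- slots o,
       uv <- [seq (u, v) | u <- bushes h (rem b (slots o)),
                           v <- canon_words h m' (Some b)]]
  else bushes h (slots o).

Lemma bushes_consP h a s u :
  reflect (exists e v, [/\ e \in excursions h a, v \in bushes h s & u = e ++ v])
          (u \in bushes h (a :: s)).
Proof.
apply: (iffP allpairsP) => [[[e v] /= [He Hv ->]]|[e [v [He Hv ->]]]].
  by exists e, v.
by exists (e, v).
Qed.

Lemma excursionsSP h a e :
  reflect (e = [::] \/ exists2 u, u \in bushes h (slots (Some a))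
                                & e = a :: u ++ [:: inv a])
          (e \in excursions h.+1 a).
Proof.
rewrite inE; apply: (iffP orP) => [[/eqP->|/mapP[u Hu ->]]|[->|[u Hu ->]]].
- by left.
- by right; exists u.
- by left.
- by right; apply/mapP; exists u.
Qed.

Lemma canonSP h m o c :
  reflect (exists b u v, [/\ b \in slots o, u \in bushes h (rem b (slots o)),
                          v \in canon_words h m (Some b) & c = u ++ b :: v])
          (c \in canon_words h m.+1 o).
Proof.
apply: (iffP allpairsPdep).
  move=> [b [[u v] [Hb /allpairsP [[u' v'] /= [Hu Hv [-> ->]]] ->]]].
  by exists b, u', v'.
move=> [b [u [v [Hb Hu Hv ->]]]]; exists b, (u, v); split => //.
by apply/allpairsP; exists (u, v).
Qed.

Lemma nil_bushes h s : [::] \in bushes h s.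
Proof.
elim: s => [|a s IH]; first by rewrite inE.
apply/bushes_consP; exists [::], [::]; split=> //.
by case: h {IH} => [|h]; rewrite inE eqxx.
Qed.

Lemma nil_excursions h a : [::] \in excursions h a.
Proof. by case: h => [|h]; rewrite inE eqxx. Qed.

Lemma excursionsS h a : {subset excursions h a <= excursions h.+1 a}.
Proof.
elim: h a => [a e|h IH a e]; first by rewrite inE => /eqP ->; exact: nil_excursions.
move/excursionsSP => [->|[u Hu ->]]; first exact: nil_excursions.
apply/excursionsSP; right; exists u => //.
elim: (slots _) u Hu => [//|b s IHs] u /bushes_consP [e' [v [He Hv ->]]].
by apply/bushes_consP; exists e', v; split => //; [exact: IH | exact: IHs].
Qed.

Lemma bushesS h s : {subset bushes h s <= bushes h.+1 s}.
Proof.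
elim: s => [//|b s IHs] u /bushes_consP [e' [v [He Hv ->]]].
by apply/bushes_consP; exists e', v; split => //; [exact: excursionsS | exact: IHs].
Qed.

Lemma canonS h m o : {subset canon_words h m o <= canon_words h.+1 m o}.
Proof.
elim: m o => [|m IH] o c; first exact: bushesS.
move/canonSP => [b [u [v [Hb Hu Hv ->]]]]; apply/canonSP; exists b, u, v.
by split=> //; [exact: bushesS | exact: IH].
Qed.

Lemma canon_leq h k m o : h <= k -> {subset canon_words h m o <= canon_words k m o}.
Proof.
move=> /subnK <-; elim: (k - h) => [//|j IH] c /IH; exact: canonS.
Qed.

(** An excursion is built from the empty word by products and conjugation by a letter, both of which
    preserve idempotents. Hence bushes at one vertex commute. *)
Lemma excursions_idem h a e : e \in excursions h a -> fim_idem e.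
Proof.
elim: h a e => [|h IH] a e; first by rewrite inE => /eqP ->; exact: fim_idem_nil.
move/excursionsSP => [->|[u Hu ->]]; first exact: fim_idem_nil.
apply: fim_idem_conj.
elim: (slots _) u Hu => [|b s IHs] u; first by rewrite inE => /eqP ->; exact: fim_idem_nil.
move=> /bushes_consP [e' [v [He Hv ->]]].
by apply: fim_idem_cat; [exact: IH He | exact: IHs].
Qed.

Lemma bushes_idem h s u : u \in bushes h s -> fim_idem u.
Proof.
elim: s u => [|b s IHs] u; first by rewrite inE => /eqP ->; exact: fim_idem_nil.
move=> /bushes_consP [e' [v [He Hv ->]]].
by apply: fim_idem_cat; [exact: excursions_idem He | exact: IHs].
Qed.

(** * Rewriting an arbitrary word into canonical form *)

(** The excursion is commuted past the bushes that precede its letter in [s]; this only permutes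
    factors, so the length is unchanged. *)
Lemma bushes_insert h s a e v : a \in s -> e \in excursions h a ->
  v \in bushes h (rem a s) ->
  exists2 u, u \in bushes h s & (e ++ v ~~~ u) /\ size u = size e + size v.
Proof.
move=> + He; elim: s v => [//|b s IH] v /=.
rewrite inE; case: (eqVneq b a) => [-> _ Hv|ba].
  exists (e ++ v); last by rewrite size_cat; split; [exact: fim_refl|].
  by apply/bushes_consP; exists e, v.
move=> Ha /bushes_consP [e' [v' [He' Hv' ->]]].
have [u Hu [eu su]] := IH _ Ha Hv'.
exists (e' ++ u); first by apply/bushes_consP; exists e', u.
rewrite !size_cat su addnCA; split=> //.
by rewrite -eu !catA (fim_idem_comm (excursions_idem He) (excursions_idem He')).
Qed.

Lemma bushes_extract h s a u : a \in s -> u \in bushes h s ->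
  exists e v, [/\ e \in excursions h a, v \in bushes h (rem a s),
    u ~~~ e ++ v & size u = size e + size v].
Proof.
elim: s u => [//|b s IH] u /=.
rewrite inE => Hab /bushes_consP [e' [v' [He' Hv' ->]]].
move: Hab; case: (eqVneq b a) => [ba _|ba].
  exists e', v'; rewrite -ba He' Hv' size_cat; split=> //; exact: fim_refl.
move=> Ha.
have [e [v [He Hv ev sv]]] := IH _ Ha Hv'.
exists e, (e' ++ v); split=> //.
- by apply/bushes_consP; exists e', v.
- by rewrite ev !catA (fim_idem_comm (excursions_idem He) (excursions_idem He')).
- by rewrite !size_cat sv addnCA.
Qed.

Lemma rem_slots_comm a b :
  rem b (rem a (slots None)) = rem a (rem b (slots None)).
Proof.
rewrite !rem_filter ?(rem_uniq, filter_uniq, slots_uniq) // -[LHS]filter_predI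
  -[RHS]filter_predI.
by apply: eq_filter => x /=; rewrite andbC.
Qed.

(** A canonical word entered through [inv a] leaves exactly the direction [a] free at its first
    vertex, and [e] fills that slot. *)
Lemma canon_insert h m a e v :
  e \in excursions h a -> v \in canon_words h m (Some (inv a)) ->
  exists2 c, c \in canon_words h m None & (e ++ v ~~~ c) /\ size c = size e + size v.
Proof.
move=> He; case: m => [|m].
  rewrite /= slots_Some inv_letterK => Hv.
  by apply: bushes_insert He Hv; rewrite mem_slots.
move/canonSP => [b [u [w [Hb Hu Hw ->]]]].
move: Hb; rewrite mem_slots => Hb.
rewrite slots_Some inv_letterK rem_slots_comm in Hu.
have [|u' Hu' [eu su]] := bushes_insert _ He Hu.
  rewrite rem_filter ?slots_uniq // mem_filter mem_slots andbT /=.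
  by apply: contraNN Hb => /eqP ->.
exists (u' ++ b :: w).
  by apply/canonSP; exists b, u', w; split=> //; rewrite mem_slots.
by rewrite catA eu !size_cat su addnA; split; first exact: fim_refl.
Qed.

(** Either the trunk leaves the root along [a], or the bush in direction [a] can be pulled to the
    front. *)
Lemma canon_extract h m a c : c \in canon_words h m None ->
  (exists e v, [/\ e \in excursions h a, v \in canon_words h m (Some (inv a)),
     c ~~~ e ++ v & size c = size e + size v]) \/
  (exists m' u v, [/\ u \in bushes h (rem a (slots None)),
     v \in canon_words h m' (Some a) & c = u ++ a :: v]).
Proof.
case: m => [/= Hc|m /canonSP [b [u [w [Hb Hu Hw ->]]]]].
  left; rewrite slots_Some inv_letterK; apply: bushes_extract Hc.
  by rewrite mem_slots.
case: (eqVneq b a) => [<-|ba]; first by right; exists m, u, w.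
left; have [|e [v [He Hv ev sv]]] := bushes_extract (a := a) _ Hu.
  by rewrite rem_filter ?slots_uniq // mem_filter mem_slots andbT /= eq_sym.
exists e, (v ++ b :: w); split=> //.
- apply/canonSP; exists b, v, w; split=> //.
    by rewrite mem_slots; apply: contraNN ba => /eqP [/(inv_inj inv_letterK) ->].
  by rewrite slots_Some inv_letterK rem_slots_comm.
- by rewrite ev catA; exact: fim_refl.
- by rewrite !size_cat sv addnA.
Qed.

(** Prepending [a] moves the root across one edge. If the trunk does not start with [inv a], it
    grows by that edge, and what hung beyond the edge becomes bushes at the new root. If it does
    start with [inv a], it loses its first edge and the old root becomes a bush at the new one,
    which is where the height may grow. *)
Lemma canon_cons h m a c : c \in canon_words h m None ->
  exists m', exists2 c', c' \in canon_words h.+1 m' None &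
    (a :: c ~~~ c') /\ size c' <= (size c).+1.
Proof.
move=> /(canon_extract (inv a)) [].
  move=> [e [v [He]]]; rewrite inv_letterK => Hv ec sc; exists m.+1.
  suff [w Hw [ew sw]] : exists2 w, w \in bushes h.+1 (slots (Some (inv a))) &
     (a :: e ~~~ w ++ [:: a]) /\ size w <= size e.
    exists (w ++ a :: v).
      apply/canonSP; exists a, w, v; split; rewrite ?mem_slots //.
        by move: Hw; rewrite slots_Some inv_letterK.
      exact: canonS.
    split; last by rewrite size_cat /= sc addnS ltnS leq_add2r.
    by rewrite ec -cat_cons ew -catA; exact: fim_refl.
  case: h He {Hv} => [|h].
    rewrite inE => /eqP ->; exists [::]; first exact: nil_bushes.
    by split; first exact: fim_refl.
  move=> /excursionsSP [->|[w Hw ->]].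
    by exists [::]; [exact: nil_bushes | split; first exact: fim_refl].
  exists w; first by do 2 apply: bushesS.
  split; last by rewrite /= size_cat -addnS leq_addr.
  (* Here a a^{-1} w a = w a a^{-1} a = w a, by commuting the idempotents a a^{-1} and w. *)
  have aa : fim_idem ([:: a] ++ [:: inv a]).
    by exists [:: a]; exact: fim_refl.
  rewrite inv_letterK; transitivity ((w ++ [:: a] ++ [:: inv a]) ++ [:: a]).
    by rewrite -(fim_idem_comm aa (bushes_idem Hw)) -!catA.
  by rewrite -!catA -[X in _ ~~~ w ++ X](fim_red [:: a]).
move=> [m' [u [v [Hu Hv ->]]]]; exists m'.
have He : a :: u ++ [:: inv a] \in excursions h.+1 a.
  by apply/excursionsSP; right; exists u => //; rewrite slots_Some.
have [c' Hc' [ec sc]] := canon_insert He (canonS Hv).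
exists c' => //; split; last by rewrite sc /= !size_cat /= addn1 addSn addSnnS.
by rewrite -ec /= -catA; exact: fim_refl.
Qed.

Lemma canon_size h m o c : c \in canon_words h m o -> m <= size c.
Proof.
elim: m o c => [//|m IH] o c /canonSP [b [u [v [_ _ /IH Hv ->]]]].
by rewrite size_cat /= addnS ltnS (leq_trans Hv) ?leq_addl.
Qed.

Lemma canon_exists w : exists m, exists2 c, c \in canon_words (size w) m None &
  (w ~~~ c) /\ size c <= size w.
Proof.
elim: w => [|a w [m [c Hc [ec sc]]]].
  exists 0, [::]; first exact: nil_bushes.
  by split; first exact: fim_refl.
have [m' [c' Hc' [ec' sc']]] := canon_cons a Hc.
exists m', c' => //; split; last exact: leq_trans sc' _.
by rewrite ec.
Qed.


End CanonicalWords.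

(** * Endpoint and visited vertices as invariants of the congruence *)

Section MunnTrees.
Variable X : finType.
Local Notation L := (letter X).
Implicit Types (a b : L) (u v w e c : seq L) (s : seq L) (o : option L).
Implicit Types (h m : nat) (g x : seq L).
Local Notation inv := (@inv_letter X).
Local Notation "u ~~~ v" := (fim_eq u v) (at level 70).

(* A vertex of the Cayley tree is a reduced word stored with its last letter
   first, so the vertices beyond the edge a at g are the x with suffix (a :: g) x. *)
Definition step g a : seq L :=
  if g is b :: g' then if b == inv a then g' else a :: g else [:: a].

Definition reduced g := sorted (fun a b => b != inv a) g.

Definition endpoint g w := foldl step g w.

Definition visits g w := g :: scanl step g w.

Lemma step_push a g : reduced (a :: g) -> step g a = a :: g.
Proof. by case: g => [//|b g] /= /andP [/negPf ->]. Qed.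

Lemma step_pop a g : step (a :: g) (inv a) = g.
Proof. by rewrite /= inv_letterK eqxx. Qed.

Lemma reduced_step g a : reduced g -> reduced (step g a).
Proof.
case: g => [//|b g] rg /=; case: eqP => [_|/eqP ba]; first exact: path_sorted rg.
by rewrite /= ba.
Qed.

Lemma stepK g a : reduced g -> step (step g a) (inv a) = g.
Proof.
case: g => [_|b g rg]; first exact: (step_pop a [::]).
rewrite {2}/step; case: eqP => [ba|_]; last exact: step_pop.
by rewrite -ba step_push.
Qed.

Lemma endpoint_cat g u v : endpoint g (u ++ v) = endpoint (endpoint g u) v.
Proof. exact: foldl_cat. Qed.

Lemma endpoint_cons g a u : endpoint g (a :: u) = endpoint (step g a) u.
Proof. by []. Qed.

Lemma reduced_endpoint g u : reduced g -> reduced (endpoint g u).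
Proof. by elim: u g => [//|a u IH] g rg; apply: IH; exact: reduced_step. Qed.

Lemma visits_cons g a u x :
  (x \in visits g (a :: u)) = (x == g) || (x \in visits (step g a) u).
Proof. by rewrite /visits /= in_cons. Qed.

Lemma visits_nil g x : (x \in visits g [::]) = (x == g).
Proof. exact: mem_seq1. Qed.

Lemma mem_visits0 g u : g \in visits g u.
Proof. exact: mem_head. Qed.

Lemma visits_cat g u v x :
  (x \in visits g (u ++ v)) = (x \in visits g u) || (x \in visits (endpoint g u) v).
Proof.
elim: u g => [|a u IH] g; last by rewrite cat_cons !visits_cons IH orbA.
by rewrite /= visits_nil; case: eqP => [->|//]; rewrite mem_visits0.
Qed.

Lemma endpointK g u : reduced g -> endpoint (endpoint g u) (inv_word u) = g.
Proof.
elim: u g => [//|a u IH] g rg.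
rewrite inv_word_cons endpoint_cat endpoint_cons IH ?reduced_step //=.
exact: stepK.
Qed.

(** The inverse word retraces the same path backwards. *)
Lemma visits_inv g u : reduced g ->
  visits (endpoint g u) (inv_word u) =i visits g u.
Proof.
elim: u g => [//|a u IH] g rg x.
rewrite inv_word_cons visits_cat visits_cons endpoint_cons IH ?reduced_step //.
rewrite endpointK ?reduced_step // visits_cons stepK // visits_nil.
case: (x == g); rewrite ?orbT //= orbF.
by case: eqP => [->|]; rewrite ?mem_visits0 ?orbF.
Qed.

(** Quantifying over the starting vertex is what lets the induction pass through concatenation,
    whose second factor starts at the endpoint of the first. *)
Lemma fim_eq_munn u v : u ~~~ v -> forall g, reduced g ->
  endpoint g u = endpoint g v /\ visits g u =i visits g v.
Proof.
elim=> {u v}.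
- by [].
- by move=> u v _ IH g /IH [-> H]; split=> // x; rewrite H.
- by move=> u v w _ IH1 _ IH2 g rg; have [-> H1] := IH1 g rg;
    have [-> H2] := IH2 g rg; split=> // x; rewrite H1.
- move=> a b c d _ IH1 _ IH2 g rg; have [e1 H1] := IH1 g rg.
  have [e2 H2] := IH2 _ (reduced_endpoint a rg).
  by rewrite !endpoint_cat e2 e1; split=> // x; rewrite !visits_cat H1 H2 e1.
- move=> u g rg; rewrite !endpoint_cat endpointK //; split=> // x.
  by rewrite !visits_cat visits_inv // endpointK // !orbb.
- move=> u v g rg; rewrite !endpoint_cat !endpointK //; split=> // x.
  rewrite !visits_cat !endpointK // !visits_inv //.
  by case: (x \in visits g u); case: (x \in visits g v).
Qed.

(** * Recovering a canonical word from its Munn tree *)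

(** Branches of the Cayley tree beyond different edges at [g] are disjoint; every separation
    argument below rests on this. *)
Lemma suffix_head a b g x : suffix (a :: g) x -> suffix (b :: g) x -> a = b.
Proof.
move=> /suffixP [s1 ->] /suffixP [s2].
rewrite -!cat_rcons => /(congr1 rev); rewrite !rev_cat => /eqP.
by rewrite eqseq_cat // eqxx => /eqP /(can_inj revK) /rcons_inj [_ ->].
Qed.

Lemma suffix_behead a g x : suffix (a :: g) x -> suffix g x.
Proof. by move=> /suffixP [s1 ->]; rewrite -cat_rcons suffix_suffix. Qed.

Lemma suffix_consF a g : suffix (a :: g) g = false.
Proof. by apply/negP => /size_suffix; rewrite ltnn. Qed.

Lemma reduced_slots a g b : reduced (a :: g) -> b \in slots (Some a) ->
  reduced (b :: a :: g).
Proof. by rewrite mem_slots /reduced /= => -> ->. Qed.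

Lemma excursions_confined h a e g : reduced (a :: g) -> e \in excursions h a ->
  endpoint g e = g /\ forall x, x \in visits g e -> x = g \/ suffix (a :: g) x.
Proof.
elim: h a e g => [|h IH] a e g rag.
  rewrite inE => /eqP ->; split=> // x; rewrite visits_nil => /eqP ->; by left.
move/excursionsSP => [->|[u Hu ->]].
  split=> // x; rewrite visits_nil => /eqP ->; by left.
suff [eu vu] : endpoint (a :: g) u = a :: g /\
    forall x, x \in visits (a :: g) u -> suffix (a :: g) x.
  split; first by rewrite /= step_push // endpoint_cat eu; exact: step_pop.
  move=> x; rewrite visits_cons => /orP [/eqP ->|]; first by left.
  rewrite step_push // visits_cat eu => /orP [/vu|]; first by right.
  rewrite visits_cons step_pop visits_nil => /orP [] /eqP ->; last by left.
  by right; exact: suffix_refl.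
(* The list is generalised to a part of the slots, so that induction can consume it while each
   letter remains a legal continuation of [a]. *)
have sub : {subset slots (Some a) <= slots (Some a)} by [].
elim: {1 3}(slots _) sub u Hu => [|b s IHs] sub u.
  rewrite inE => /eqP ->; split=> // x; rewrite visits_nil => /eqP ->; exact: suffix_refl.
move=> /bushes_consP [e' [v [He Hv ->]]].
have Hb := sub b (mem_head _ _).
have [ee ve] := IH _ _ _ (reduced_slots rag Hb) He.
have [|ev vv] := IHs _ _ Hv; first by move=> y ys; apply: sub; rewrite inE ys orbT.
rewrite endpoint_cat ee ev; split=> // x; rewrite visits_cat ee => /orP [|/vv //].
by move/ve => [->|/suffix_behead //]; exact: suffix_refl.
Qed.

Lemma bushes_confined h s u g : {in s, forall a, reduced (a :: g)} ->
  u \in bushes h s ->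
  endpoint g u = g /\
  forall x, x \in visits g u -> x = g \/ exists2 a, a \in s & suffix (a :: g) x.
Proof.
elim: s u => [|b s IHs] u rs.
  rewrite inE => /eqP ->; split=> // x; rewrite visits_nil => /eqP ->; by left.
move=> /bushes_consP [e' [v [He Hv ->]]].
have [ee ve] := excursions_confined (rs b (mem_head _ _)) He.
have [|ev vv] := IHs v _ Hv; first by move=> y ys; apply: rs; rewrite inE ys orbT.
rewrite endpoint_cat ee ev; split=> // x; rewrite visits_cat ee => /orP [/ve|/vv].
  by case=> [->|]; [left | right; exists b; rewrite ?mem_head].
by case=> [->|[a Ha]]; [left | right; exists a; rewrite // inE Ha orbT].
Qed.

Lemma canon_confined h m o c g : {in slots o, forall a, reduced (a :: g)} ->
  c \in canon_words h m o ->
  [/\ suffix g (endpoint g c), size (endpoint g c) = m + size g &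
      forall x, x \in visits g c -> suffix g x].
Proof.
elim: m o c g => [|m IH] o c g rs.
  move=> /(bushes_confined rs) [-> H]; rewrite suffix_refl; split=> // x.
  by move/H => [->|[a _ /suffix_behead //]]; exact: suffix_refl.
move/canonSP => [b [u [v [Hb Hu Hv ->]]]].
have rb := rs _ Hb.
have [|eu vu] := bushes_confined (g := g) _ Hu.
  by move=> a /mem_rem; exact: rs.
have [|e1 e2 e3] := IH _ _ (b :: g) _ Hv; first by move=> a; exact: reduced_slots.
rewrite endpoint_cat eu endpoint_cons step_push // e2 addnS.
split=> //; first exact: suffix_behead e1.
move=> x; rewrite visits_cat eu visits_cons step_push // => /or3P [/vu| /eqP ->|/e3].
- by case=> [->|[a _ /suffix_behead //]]; exact: suffix_refl.
- exact: suffix_refl.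
- exact: suffix_behead.
Qed.

(** Each factor stays in its own branches, so restricting the visited set to a branch isolates the
    factor living there. *)
Lemma bushes_split h a s e v g : a \notin s ->
  {in a :: s, forall b, reduced (b :: g)} ->
  e \in excursions h a -> v \in bushes h s ->
  (forall x, suffix (a :: g) x -> (x \in visits g (e ++ v)) = (x \in visits g e)) /\
  {in s, forall b, forall x, suffix (b :: g) x ->
    (x \in visits g (e ++ v)) = (x \in visits g v)}.
Proof.
move=> sa rs He Hv.
have [|ee ve] := excursions_confined (g := g) _ He; first by apply: rs; exact: mem_head.
have [|_ vv] := bushes_confined (g := g) _ Hv.
  by move=> b bs; apply: rs; rewrite inE bs orbT.
split=> [x ax|b bs x bx]; rewrite visits_cat ee.
  have -> : (x \in visits g v) = false; last by rewrite orbF.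
  apply/negP => /vv [xg|[b bs bx]]; first by rewrite xg suffix_consF in ax.
  by rewrite (suffix_head ax bx) bs in sa.
have -> // : (x \in visits g e) = false.
apply/negP => /ve [xg|ax]; first by rewrite xg suffix_consF in bx.
by rewrite (suffix_head ax bx) bs in sa.
Qed.

(** Injectivity for excursions is a hypothesis here because the two injectivity statements are
    proved by a mutual induction on the height. *)
Lemma bushes_inj_of h :
  (forall a e e' g, reduced (a :: g) -> e \in excursions h a ->
    e' \in excursions h a ->
    (forall x, suffix (a :: g) x -> (x \in visits g e) = (x \in visits g e')) ->
    e = e') ->
  forall s u u' g, uniq s -> {in s, forall a, reduced (a :: g)} ->
    u \in bushes h s -> u' \in bushes h s ->
    {in s, forall a, forall x, suffix (a :: g) x ->
      (x \in visits g u) = (x \in visits g u')} ->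
    u = u'.
Proof.
move=> inj; elim=> [|a s IH] u u' g.
  by rewrite !inE => _ _ /eqP -> /eqP ->.
move=> /= /andP [sa us] rs /bushes_consP [e [v [He Hv ->]]].
move=> /bushes_consP [e' [v' [He' Hv' ->]]] H.
have [ve vv] := bushes_split sa rs He Hv.
have [ve' vv'] := bushes_split sa rs He' Hv'.
congr (_ ++ _).
  apply: inj He He' _; first by apply: rs; exact: mem_head.
  by move=> x ax; rewrite -ve // -ve' //; apply: H ax; exact: mem_head.
apply: IH us _ Hv Hv' _; first by move=> b bs; apply: rs; rewrite inE bs orbT.
by move=> b bs x bx; rewrite -(vv b) // -(vv' b) //; apply: H bx; rewrite inE bs orbT.
Qed.

Lemma excursions_inj h a e e' g : reduced (a :: g) -> e \in excursions h a ->
  e' \in excursions h a ->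
  (forall x, suffix (a :: g) x -> (x \in visits g e) = (x \in visits g e')) ->
  e = e'.
Proof.
elim: h a e e' g => [|h IH] a e e' g ra.
  by rewrite !inE => /eqP -> /eqP ->.
(* The vertex just beyond the edge tells a nonempty excursion from the empty one. *)
have visited u : a :: g \in visits g (a :: u ++ [:: inv a]).
  by rewrite visits_cons step_push // mem_visits0 orbT.
have not_visited : (a :: g \in visits g [::]) = false.
  by rewrite visits_nil; apply/negP => /eqP /(congr1 size) /= /esym /n_Sn.
move/excursionsSP => [->|[u Hu ->]]; move/excursionsSP => [->|[u' Hu' ->]] // H.
- by move: (H _ (suffix_refl _)); rewrite visited not_visited.
- by move: (H _ (suffix_refl _)); rewrite visited not_visited.
have rs : {in slots (Some a), forall b, reduced (b :: a :: g)}.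
  by move=> b; exact: reduced_slots.
congr (_ :: _ ++ _).
apply: (bushes_inj_of IH _ rs Hu Hu') => [|b Hb x bx]; first exact: slots_uniq.
have [eu _] := bushes_confined rs Hu; have [eu' _] := bushes_confined rs Hu'.
have := H x (suffix_behead bx).
rewrite !visits_cons step_push // !visits_cat eu eu' !visits_cons step_pop !visits_nil.
have -> : (x == g) = false.
  by apply/negP => /eqP xg; have := suffix_behead bx; rewrite xg suffix_consF.
have -> : (x == a :: g) = false.
  by apply/negP => /eqP xg; have := bx; rewrite xg suffix_consF.
by rewrite !orbF.
Qed.

Lemma bushes_inj h s u u' g : uniq s -> {in s, forall a, reduced (a :: g)} ->
  u \in bushes h s -> u' \in bushes h s ->
  {in s, forall a, forall x, suffix (a :: g) x ->
    (x \in visits g u) = (x \in visits g u')} ->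
  u = u'.
Proof. by apply: bushes_inj_of; exact: excursions_inj. Qed.

Lemma canon_split h m o b u v g : {in slots o, forall a, reduced (a :: g)} ->
  b \in slots o -> u \in bushes h (rem b (slots o)) -> v \in canon_words h m (Some b) ->
  [/\ endpoint g (u ++ b :: v) = endpoint (b :: g) v,
    suffix (b :: g) (endpoint (b :: g) v),
    {in rem b (slots o), forall a, forall x, suffix (a :: g) x ->
      (x \in visits g (u ++ b :: v)) = (x \in visits g u)} &
    forall x, suffix (b :: g) x ->
      (x \in visits g (u ++ b :: v)) = (x \in visits (b :: g) v)].
Proof.
move=> rs Hb Hu Hv.
have rs' : {in rem b (slots o), forall a, reduced (a :: g)}.
  by move=> a /mem_rem; exact: rs.
have [eu vu] := bushes_confined rs' Hu.
have [|ev _ vv] := canon_confined (g := b :: g) _ Hv.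
  by move=> a; apply: reduced_slots; exact: rs.
rewrite endpoint_cat eu endpoint_cons step_push ?rs //; split=> //.
  move=> a; rewrite mem_rem_uniq ?slots_uniq // inE => /andP [ab _] x ax.
  rewrite visits_cat eu visits_cons step_push ?rs //.
  have -> : (x == g) = false.
    by apply/negP => /eqP xg; rewrite xg suffix_consF in ax.
  have -> : (x \in visits (b :: g) v) = false; last by rewrite !orbF.
  by apply/negP => /vv bx; rewrite (suffix_head ax bx) eqxx in ab.
move=> x bx; rewrite visits_cat eu visits_cons step_push ?rs //.
have -> : (x == g) = false.
  by apply/negP => /eqP xg; rewrite xg suffix_consF in bx.
have -> // : (x \in visits g u) = false.
apply/negP => /vu [xg|[a]]; first by rewrite xg suffix_consF in bx.
rewrite mem_rem_uniq ?slots_uniq // inE => /andP [ab _] ax.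
by rewrite (suffix_head ax bx) eqxx in ab.
Qed.

(** The endpoint lies beyond exactly one edge at [g], which is the next trunk edge; the other
    branches determine the bushes, and the argument repeats one vertex further. *)
Lemma canon_inj h m o c c' g : {in slots o, forall a, reduced (a :: g)} ->
  c \in canon_words h m o -> c' \in canon_words h m o ->
  endpoint g c = endpoint g c' ->
  {in slots o, forall a, forall x, suffix (a :: g) x ->
    (x \in visits g c) = (x \in visits g c')} ->
  c = c'.
Proof.
elim: m o c c' g => [|m IH] o c c' g rs.
  by move=> Hc Hc' _; apply: bushes_inj rs Hc Hc'; exact: slots_uniq.
move/canonSP => [b [u [v [Hb Hu Hv ->]]]].
move/canonSP => [b' [u' [v' [Hb' Hu' Hv' ->]]]].
have [-> ev vu vv] := canon_split rs Hb Hu Hv.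
have [-> ev' vu' vv'] := canon_split rs Hb' Hu' Hv'.
move=> E H; move: (ev'); rewrite -E => /suffix_head /(_ ev) bb'.
move: bb' Hb' Hu' Hv' E H ev' vu' vv' => -> Hb' Hu' Hv' E H ev' vu' vv'.
congr (_ ++ _ :: _).
  apply: bushes_inj Hu Hu' _; first by rewrite rem_uniq ?slots_uniq.
    by move=> a /mem_rem; exact: rs.
  move=> a Ha x ax; rewrite -(vu a) // -(vu' a) //.
  by apply: (H a) => //; exact: mem_rem Ha.
apply: (IH _ _ _ (b :: g)) Hv Hv' E _; first by move=> a; apply: reduced_slots; exact: rs.
move=> a Ha x ax; rewrite -vv ?(suffix_behead ax) // -vv' ?(suffix_behead ax) //.
by apply: (H b) => //; exact: suffix_behead ax.
Qed.

(** The trunk length is the length of the reduced endpoint, so it agrees; the height bounds are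
    raised to their maximum. *)
Lemma canon_fim_inj h h' m m' c c' : c \in canon_words h m None ->
  c' \in canon_words h' m' None -> c ~~~ c' -> c = c'.
Proof.
move=> Hc Hc' /fim_eq_munn /(_ [::] isT) [E V].
have rs : {in slots (@None L), forall a, reduced [:: a]} by [].
have mm : m = m'.
  have [_ + _] := canon_confined rs Hc; have [_ + _] := canon_confined rs Hc'.
  by rewrite E !addn0 => -> ->.
rewrite -{}mm in Hc'.
apply: (canon_inj rs (canon_leq (leq_maxl h h') Hc) (canon_leq (leq_maxr h h') Hc'))
  => //.
Qed.

(** A congruent word rewrites to a canonical word that is no longer, and by injectivity that word is
    [c] itself. *)
Lemma canon_geodesic h m c : c \in canon_words h m None -> fim_geodesic c.
Proof.
move=> Hc w cw; have [m' [c' Hc' [wc' sc']]] := canon_exists w.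
by rewrite (canon_fim_inj Hc Hc' (fim_trans cw wc')).
Qed.

Lemma uniq_bushes_of h s g : (forall a, uniq (excursions h a)) ->
  uniq s -> {in s, forall a, reduced (a :: g)} -> uniq (bushes h s).
Proof.
move=> ue; elim: s => [//|b s IHs] /= /andP [sb us] rs.
apply: allpairs_uniq => //.
  by apply: IHs => // y ys; apply: rs; rewrite inE ys orbT.
move=> _ _ /allpairsP [[e u] /= [He Hu ->]] /allpairsP [[e' u'] /= [He' Hu' ->]] /= E.
have [ve _] := bushes_split sb rs He Hu.
have [ve' _] := bushes_split sb rs He' Hu'.
have ee : e = e'.
  apply: excursions_inj He He' _; first by apply: rs; exact: mem_head.
  by move=> x bx; rewrite -ve // -ve' // E.
by move: E; rewrite ee => /eqP; rewrite eqseq_cat // eqxx => /eqP ->.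
Qed.

Lemma uniq_excursions h a : uniq (excursions h a).
Proof.
elim: h a => [//|h IH] a /=.
apply/andP; split; first by apply/mapP => -[].
rewrite map_inj_uniq; last first.
  by move=> u u' [] /eqP; rewrite !cats1 eqseq_rcons => /andP [/eqP].
apply: (uniq_bushes_of (g := [:: a])) => //; first exact: slots_uniq.
by move=> b; exact: reduced_slots.
Qed.

Lemma uniq_bushes h s g : uniq s -> {in s, forall a, reduced (a :: g)} ->
  uniq (bushes h s).
Proof. by apply: uniq_bushes_of; exact: uniq_excursions. Qed.

(** The parsing is unique: endpoint and visited set of the word give back its first trunk letter and
    its bushes. List entries may therefore be counted as words. *)
Lemma uniq_canon h m o g : {in slots o, forall a, reduced (a :: g)} ->
  uniq (canon_words h m o).
Proof.
elim: m o g => [|m IH] o g rs; first exact: uniq_bushes (slots_uniq o) rs.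
apply: allpairs_uniq_dep; first exact: slots_uniq.
  move=> b Hb; apply: allpairs_uniq => [||[? ?] [? ?] _ _ [-> ->] //].
    apply: (@uniq_bushes _ _ g); first by rewrite rem_uniq ?slots_uniq.
    by move=> a /mem_rem; exact: rs.
  by apply: (IH _ (b :: g)) => a; apply: reduced_slots; exact: rs.
move=> p p' /allpairsPdep [b [_ [Hb /allpairsP [[u v] /= [Hu Hv ->]] ->]]].
move=> /allpairsPdep [b' [_ [Hb' /allpairsP [[u' v'] /= [Hu' Hv' ->]] ->]]] /= E.
have [E1 ev vu _] := canon_split rs Hb Hu Hv.
have [E2 ev' vu' _] := canon_split rs Hb' Hu' Hv'.
move: (ev'); rewrite -E2 -E E1 => /suffix_head /(_ ev) bb'.
move: bb' Hb' Hu' Hv' E vu' {E1 E2 ev ev'} => -> Hb' Hu' Hv' E vu'.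
have uu : u = u'.
  apply: bushes_inj Hu Hu' _; first by rewrite rem_uniq ?slots_uniq.
    by move=> a /mem_rem; exact: rs.
  by move=> a Ha x ax; rewrite -(vu a) // -(vu' a) // E.
by move: E; rewrite uu => /eqP; rewrite eqseq_cat // eqxx => /eqP [->].
Qed.

End MunnTrees.

(** * Sphere sizes as numbers of canonical words *)

Section Counting.
Variable X : finType.
Local Notation L := (letter X).
Implicit Types (U V : seq (seq L)) (h m K : nat).

Lemma card_tuples_le K U :
  #|[set w : K.-tuple L | tval w \in U]| <= count (fun w => size w == K) U.
Proof.
rewrite cardE -(size_map (@tval K L)) -size_filter; apply: uniq_leq_size.
  by rewrite map_inj_uniq ?enum_uniq //; exact: val_inj.
move=> _ /mapP [w + ->]; rewrite mem_enum inE mem_filter => ->.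
by rewrite size_tuple eqxx.
Qed.

Lemma count_le_card_tuples K U : uniq U ->
  count (fun w => size w == K) U <= #|[set w : K.-tuple L | tval w \in U]|.
Proof.
move=> uU; rewrite cardE -(size_map (@tval K L)) -size_filter.
apply: uniq_leq_size; first exact: filter_uniq.
move=> w; rewrite mem_filter => /andP [sw wU]; apply/mapP; exists (Tuple sw) => //.
by rewrite mem_enum inE.
Qed.

Lemma fim_sphere_card_le K :
  fim_sphere_card X K <=
  \sum_(m < K.+1) count (fun w => size w == K) (canon_words K m (@None L)).
Proof.
pose U := flatten [seq canon_words K m (@None L) | m <- iota 0 K.+1].
have -> : \sum_(m < K.+1) count (fun w => size w == K) (canon_words K m (@None L))
    = count (fun w => size w == K) U.
  rewrite /U count_flatten -map_comp sumnE big_map -[iota _ _]/(index_iota 0 K.+1).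
  by rewrite big_mkord.
apply: leq_trans (card_tuples_le K U).
pose cls := fun w : K.-tuple L =>
  [set w' : K.-tuple L | `[< fim_eq (tval w) (tval w') >]]%SET.
apply: leq_trans (leq_imset_card cls _); apply: subset_leq_card.
apply/fintype.subsetP => _ /imsetP [w + ->]; rewrite inE => /asboolP gw.
have [m [c Hc [wc sc]]] := canon_exists w.
rewrite size_tuple in Hc sc.
(* The canonical representative is no longer than [w], and [w] is geodesic, so the lengths agree. *)
have sK : size c == K.
  by rewrite eqn_leq sc -{1}(size_tuple w) gw.
apply/imsetP; exists (Tuple sK).
  rewrite inE; apply/flatten_mapP; exists m => //.
  by rewrite mem_iota /= add0n ltnS -(eqP sK) (canon_size Hc).
apply/setP => v; rewrite !inE; apply/idP/idP => /asboolP H; apply/asboolP.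
  exact: fim_trans (fim_sym wc) H.
exact: fim_trans wc H.
Qed.

(** Canonical words are geodesic and pairwise incongruent, so any one height bound and trunk length
    give a lower bound. *)
Lemma fim_sphere_card_ge K h m :
  count (fun w => size w == K) (canon_words h m (@None L)) <= fim_sphere_card X K.
Proof.
apply: leq_trans (count_le_card_tuples K _) _.
  by apply: (@uniq_canon _ _ _ _ [::]).
rewrite -(card_in_imset (f := fun w : K.-tuple L =>
    [set w' : K.-tuple L | `[< fim_eq (tval w) (tval w') >]]%SET)).
  apply: subset_leq_card; apply: imsetS; apply/fintype.subsetP => w.
  by rewrite !inE; exact: canon_geodesic.
move=> w w'; rewrite !inE => Hw Hw' /setP /(_ w'); rewrite !inE.
have -> : `[< fim_eq (tval w') (tval w') >] by apply/asboolP; exact: fim_refl.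
by move/asboolP => H; apply: val_inj; exact: canon_fim_inj Hw Hw' H.
Qed.

End Counting.

(** * Generating sums of canonical words by length *)

Section Weights.
Variables (R : realType) (X : finType).
Local Notation L := (letter X).
Implicit Types (U V : seq (seq L)) (h m K : nat) (z : R).
Local Open Scope ring_scope.

Definition weight z U := \sum_(w <- U) z ^+ size w.

Lemma weight_cat z U V :
  weight z [seq u ++ v | u <- U, v <- V] = weight z U * weight z V.
Proof.
rewrite /weight big_allpairs_dep big_distrl /=; apply: eq_bigr => u _.
by rewrite big_distrr; apply: eq_bigr => v _; rewrite size_cat exprD.
Qed.

Lemma weight_count z U B : (forall w, w \in U -> size w < B)%N ->
  weight z U = \sum_(K < B) (count (fun w => size w == K) U)%:R * z ^+ K.
Proof.
move=> UB; transitivity (\sum_(w <- U) \sum_(K < B | size w == K) z ^+ K).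
  rewrite /weight !big_seq; apply: eq_bigr => w /UB sw.
  by rewrite (big_pred1 (Ordinal sw)) // => K; rewrite eq_sym.
rewrite (exchange_big_dep predT) //=; apply: eq_bigr => K _.
rewrite -sum1_count natr_sum big_distrl /=; by apply: eq_bigr => w _; rewrite mul1r.
Qed.

Lemma count_le_weight z U K : 0 <= z ->
  (count (fun w => size w == K) U)%:R * z ^+ K <= weight z U.
Proof.
move=> z0; rewrite -sum1_count natr_sum big_distrl /weight /=.
rewrite big_mkcond; apply: ler_sum => w _.
by case: eqP => [->|_]; rewrite ?mul1r // exprn_ge0.
Qed.

Lemma fim_sphere_card_upper z K : 0 <= z ->
  (fim_sphere_card X K)%:R * z ^+ K <= \sum_(m < K.+1) weight z (canon_words K m (@None L)).
Proof.
move=> z0; have le := fim_sphere_card_le X K; rewrite -(ler_nat R) in le.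
apply: le_trans (ler_wpM2r (exprn_ge0 K z0) le) _.
by rewrite natr_sum big_distrl; apply: ler_sum => m _; exact: count_le_weight.
Qed.

Lemma fim_sphere_card_lower z h m : 0 <= z ->
  exists B, weight z (canon_words h m (@None L)) <=
    \sum_(K < B) (fim_sphere_card X K)%:R * z ^+ K.
Proof.
move=> z0; set U := canon_words h m (@None L).
exists (\max_(w <- U) size w).+1; rewrite (weight_count _ (B := (\max_(w <- U) size w).+1)).
  apply: ler_sum => K _; apply: ler_wpM2r; first exact: exprn_ge0.
  by rewrite ler_nat; exact: fim_sphere_card_ge.
by move=> w wU; rewrite ltnS; exact: leq_bigmax_seq.
Qed.

(** The truncation of C(z^2) to bushes of height at most [h]: the iteration of x -> 1 + z^2 x^p
    started at 1. *)
Fixpoint tree_weight (p : nat) z h : R :=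
  if h is h'.+1 then 1 + z ^+ 2 * tree_weight p z h' ^+ p else 1.

Local Notation p := (2 * #|X|).-1.

Lemma card_letter : #|{: L}| = (2 * #|X|)%N.
Proof. by rewrite card_sum mul2n addnn. Qed.

Lemma size_slots_None : size (slots (@None L)) = (2 * #|X|)%N.
Proof.
rewrite -card_letter cardT /slots; congr size.
by rewrite -[RHS]filter_predT.
Qed.

Lemma size_slots_Some (a : L) : size (slots (Some a)) = p.
Proof. by rewrite slots_Some size_rem ?mem_slots // size_slots_None. Qed.

Lemma weight_bushes_of z h x : (forall a, weight z (excursions (X := X) h a) = x) ->
  forall s, weight z (bushes (X := X) h s) = x ^+ size s.
Proof.
move=> Hx; elim=> [|a s IH]; first by rewrite /weight big_seq1.
by rewrite [LHS]weight_cat Hx IH exprS.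
Qed.

Lemma weight_excursions z h a : weight z (excursions (X := X) h a) = tree_weight p z h.
Proof.
elim: h a => [|h IH] a; first by rewrite /weight big_seq1.
rewrite /weight big_cons big_map /=; congr (_ + _).
have <- : weight z (bushes h (slots (Some a))) = tree_weight p z h ^+ p.
  by rewrite (weight_bushes_of IH) size_slots_Some.
rewrite /weight big_distrr.
by apply: eq_bigr => u _; rewrite /= size_cat addn1 -exprD.
Qed.

Lemma weight_bushes z h s : weight z (bushes (X := X) h s) = tree_weight p z h ^+ size s.
Proof. by apply: weight_bushes_of; exact: weight_excursions. Qed.

(** By symmetry the continuation has the same weight [x] for every trunk letter; one slot is taken
    by the trunk, the others carry bushes. *)
Lemma weight_canonS z h m o x :
  (forall b, weight z (canon_words h m (Some b)) = x) ->
  weight z (canon_words h m.+1 o) =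
    (size (slots o))%:R * z * tree_weight p z h ^+ (size (slots o)).-1 * x.
Proof.
move=> Hx; rewrite /weight big_allpairs_dep.
transitivity (\sum_(b <- slots o) z * tree_weight p z h ^+ (size (slots o)).-1 * x).
  rewrite big_seq [RHS]big_seq; apply: eq_bigr => b Hb.
  rewrite -(size_rem Hb) -weight_bushes -(Hx b) big_allpairs_dep /weight.
  rewrite -mulrA big_distrl big_distrr; apply: eq_bigr => u _ /=.
  rewrite !big_distrr; apply: eq_bigr => v _ /=.
  by rewrite size_cat /= addnS exprS exprD.
by rewrite big_const_seq count_predT iter_addr_0 -!mulrA mulr_natl.
Qed.

Lemma weight_canon_Some z h m a :
  weight z (canon_words h m (Some a)) =
    tree_weight p z h ^+ p * (p%:R * z * tree_weight p z h ^+ p.-1) ^+ m.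
Proof.
elim: m a => [|m IH] a; first by rewrite weight_bushes size_slots_Some mulr1.
by rewrite (weight_canonS _ IH) size_slots_Some exprS mulrCA.
Qed.

Lemma weight_canon_None0 z h :
  weight z (canon_words h 0 (@None L)) = tree_weight p z h ^+ (2 * #|X|).
Proof. by rewrite weight_bushes size_slots_None. Qed.

Lemma weight_canon_NoneS z h m :
  weight z (canon_words h m.+1 (@None L)) =
    (2 * #|X|)%:R * z * tree_weight p z h ^+ p *
    (tree_weight p z h ^+ p * (p%:R * z * tree_weight p z h ^+ p.-1) ^+ m).
Proof. by rewrite (weight_canonS _ (weight_canon_Some z h m)) size_slots_None. Qed.

End Weights.

(** * The algebraic equation and the fixed-point iteration *)

Section RealAnalysis.
Variable R : realType.
Local Open Scope ring_scope.
Implicit Types (x y z c q : R) (n h k : nat).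

Lemma bernoulli_ineq x n : -1 <= x -> 1 + n%:R * x <= (1 + x) ^+ n.
Proof.
move=> x1; elim: n => [|n IH]; first by rewrite mul0r addr0.
rewrite exprS; apply: le_trans (_ : (1 + x) * (1 + n%:R * x) <= _); last first.
  by apply: ler_wpM2l => //; lra.
have : 0 <= n%:R * x ^+ 2 by rewrite mulr_ge0 ?sqr_ge0.
by rewrite -natr1; nra.
Qed.

Lemma expr_unbounded q x : 1 < q -> exists n, forall k, (n <= k)%N -> x <= q ^+ k.
Proof.
move=> q1; exists (Num.bound (`|x| / (q - 1))) => k nk.
have q0 : 0 < q - 1 by rewrite subr_gt0.
have b : `|x| / (q - 1) <= k%:R.
  apply: le_trans (ltW (archi_boundP _)) _; first by rewrite divr_ge0 // ltW.
  by rewrite ler_nat.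
rewrite ler_pdivrMr // in b.
have qm1 : -1 <= q - 1 by lra.
have := bernoulli_ineq k qm1; rewrite (_ : 1 + (q - 1) = q); last by ring.
by have := ler_norm x; lra.
Qed.

Lemma geometric_sum_le q n : 0 <= q -> q < 1 -> \sum_(i < n) q ^+ i <= (1 - q)^-1.
Proof.
move=> q0 q1; have d0 : 0 < 1 - q by rewrite subr_gt0.
rewrite -[leRHS]mul1r ler_pdivlMr // mulrC.
have := subrX1 q n; have := exprn_ge0 n q0; lra.
Qed.

(** A sign change on [P, P+1] gives a root. It is the largest because (P x - 1)^(q+1) / x^q = (P -
    1/x)^q (P x - 1) is strictly increasing for x > 1/P. *)
Lemma growth_equation_root (q : nat) : (0 < q)%N ->
  let P : R := q.+2%:R in
  exists y, [/\ P < y < P + 1, P ^+ q.+2 * y ^+ q = (P * y - 1) ^+ q.+1 &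
      forall z, P ^+ q.+2 * z ^+ q = (P * z - 1) ^+ q.+1 -> z <= y].
Proof.
move=> q0 P.
have P3 : 3 <= P by rewrite /P ler_nat.
pose F : {poly R} := (P *: 'X - 1) ^+ q.+1 - P ^+ q.+2 *: 'X^q.
have FE x : F.[x] = (P * x - 1) ^+ q.+1 - P ^+ q.+2 * x ^+ q.
  by rewrite !hornerE.
(* At P the value is (P^2 - 1)^(q+1) - (P^2)^(q+1). *)
have F1 : F.[P] < 0.
  rewrite FE subr_lt0 -exprD (_ : (q.+2 + q = 2 * q.+1)%N); last by lia.
  by rewrite exprM ltrXn2r // ?nnegrE; nra.
(* With Q = P (P+1), the claim is P^2 Q^q < (Q - 1)^(q+1). Bernoulli bounds the right side below by
   Q^q (Q - (q+1)), and Q - (q+1) = P^2 + 1. *)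
have F2 : 0 < F.[P + 1].
  rewrite FE subr_gt0; set Q := P * (P + 1).
  have Q0 : 0 < Q by rewrite /Q; nra.
  have -> : P ^+ q.+2 * (P + 1) ^+ q = P ^+ 2 * Q ^+ q.
    by rewrite /Q exprMn -addn2 exprD; ring.
  have -> : Q - 1 = Q * (1 - Q^-1) by field; rewrite gt_eqF.
  rewrite [ltRHS]exprMn; apply: lt_le_trans (_ : Q ^+ q.+1 * (1 - q.+1%:R * Q^-1) <= _).
    have -> : Q ^+ q.+1 * (1 - q.+1%:R * Q^-1) = Q ^+ q * (Q - q.+1%:R).
      by rewrite exprSr; field; rewrite gt_eqF.
    rewrite [ltLHS]mulrC ltr_pM2l ?exprn_gt0 // /Q.
    by have PE : P = q.+1%:R + 1 by [rewrite natr1]; rewrite PE expr2; nra.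
  apply: ler_wpM2l; first by rewrite exprn_ge0 // ltW.
  rewrite -mulrN; apply: bernoulli_ineq.
  by rewrite lerN2 invf_le1 // /Q; nra.
have [||y /andP [y1 y2] /rootP Fy] := @poly_ivt _ F P (P + 1) _ _.
- by rewrite lerDl.
- by rewrite !ltW.
have Ey : P ^+ q.+2 * y ^+ q = (P * y - 1) ^+ q.+1.
  by apply/esym/eqP; rewrite -subr_eq0 -FE Fy.
exists y; split=> //.
  rewrite !lt_neqAle y1 y2 !andbT; apply/andP; split; apply/eqP => E.
    by move: F1; rewrite E Fy ltxx.
  by move: F2; rewrite -E Fy ltxx.
move=> z Ez; rewrite leNgt; apply/negP => yz.
have y0 : 0 < y by lra.
have z0 : 0 < z by lra.
have a0 : 0 < P * y - 1 by nra.
have : (P * y - 1) ^+ q.+1 * z ^+ q = (P * z - 1) ^+ q.+1 * y ^+ q.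
  by rewrite -Ey -Ez mulrAC.
apply/eqP; rewrite lt_eqF //.
rewrite !exprSr mulrAC -exprMn [ltRHS]mulrAC -exprMn.
have ab : (P * y - 1) * z < (P * z - 1) * y by nra.
apply: le_lt_trans (_ : ((P * z - 1) * y) ^+ q * (P * y - 1) < _).
  rewrite ler_wpM2r ?(ltW a0) // lerXn2r ?nnegrE ?(ltW ab) // ltW // mulr_gt0 //; nra.
by rewrite ltr_pM2l; [nra | rewrite exprn_gt0 //; nra].
Qed.

Lemma tree_weight_ge1 p z h : 1 <= tree_weight p z h.
Proof.
elim: h => [//|h IH] /=; rewrite lerDl mulr_ge0 ?sqr_ge0 ?exprn_ge0 //.
exact: le_trans IH.
Qed.

Lemma tree_weight_le p z z' h : 0 <= z -> z <= z' ->
  tree_weight p z h <= tree_weight p z' h.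
Proof.
move=> z0 zz; elim: h => [//|h IH] /=; rewrite lerD2l.
have t0 := le_trans ler01 (tree_weight_ge1 p z h).
apply: ler_pM => //; rewrite ?exprn_ge0 // lerXn2r // ?nnegrE //.
- exact: le_trans zz.
- exact: le_trans IH.
Qed.

Lemma tree_weight_bound p z c h : 1 <= c -> 1 + z ^+ 2 * c ^+ p <= c ->
  tree_weight p z h <= c.
Proof.
move=> c1 cfix; elim: h => [//|h IH] /=; apply: le_trans cfix.
rewrite lerD2l ler_wpM2l ?sqr_ge0 // lerXn2r // nnegrE.
  by apply: le_trans (tree_weight_ge1 p z h).
exact: le_trans c1.
Qed.

(* The slope of x |-> 1 + z^2 x^p at its fixed point c is p z^2 c^(p-1) = z,
   so that the iteration converges geometrically to c. *)
Lemma tree_weight_cvg p z c h : 0 <= z -> 1 <= c -> 1 + z ^+ 2 * c ^+ p.+1 = c ->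
  p.+1%:R * z * c ^+ p = 1 -> c - tree_weight p.+1 z h <= z ^+ h * c.
Proof.
move=> z0 c1 cfix slope; elim: h => [|h IH] /=; first by rewrite mul1r; lra.
set t := tree_weight _ _ _ in IH *.
have t1 : 1 <= t := tree_weight_ge1 _ _ _.
have tc : t <= c by apply: tree_weight_bound; rewrite ?cfix.
have [t0 c0] : 0 <= t /\ 0 <= c by split; lra.
(* A mean value bound: in the factorisation of the difference of powers, each of the p+1 summands is
   at most c^p. *)
have diff : c ^+ p.+1 - t ^+ p.+1 <= (c - t) * (p.+1%:R * c ^+ p).
  rewrite subrXX ler_wpM2l ?subr_ge0 //.
  rewrite [leRHS]mulr_natl -[X in _ *+ X]card_ord -sumr_const ler_sum // => i _.
  have -> : c ^+ p = c ^+ (p - i) * c ^+ i by rewrite -exprD subnK // -ltnS.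
  by rewrite ler_wpM2l ?exprn_ge0 // lerXn2r.
have -> : c - (1 + z ^+ 2 * t ^+ p.+1) = z ^+ 2 * (c ^+ p.+1 - t ^+ p.+1).
  by rewrite -{1}cfix; ring.
apply: le_trans (_ : z ^+ 2 * ((c - t) * (p.+1%:R * c ^+ p)) <= _).
  by rewrite ler_wpM2l ?sqr_ge0.
have -> : z ^+ 2 * ((c - t) * (p.+1%:R * c ^+ p)) = z * (c - t).
  transitivity (z * (c - t) * (p.+1%:R * z * c ^+ p)); first by ring.
  by rewrite slope mulr1.
by rewrite exprS -mulrA ler_wpM2l.
Qed.

End RealAnalysis.

(** * Root test: growth rate against convergence of the series *)

Section GrowthRate.
Variable R : realType.
Local Open Scope ring_scope.
Implicit Types (N : nat -> R) (y z r : R).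

Lemma root_powR_expr N k : (0 < k)%N -> 0 <= N k -> (N k `^ k%:R^-1) ^+ k = N k.
Proof.
move=> k0 N0; rewrite -powR_mulrn ?powR_ge0 // -powRrM mulVf ?pnatr_eq0 -?lt0n //.
exact: powRr1.
Qed.

Lemma root_powR_le N k r : (0 < k)%N -> 0 <= N k -> 0 <= r ->
  (N k `^ k%:R^-1 <= r) = (N k <= r ^+ k).
Proof.
move=> k0 N0 r0; rewrite -{2}(root_powR_expr k0 N0).
by rewrite ler_pXn2r // nnegrE powR_ge0.
Qed.

Lemma ler_sum_restrict N m k : (forall K, 0 <= N K) ->
  \sum_(K < m) (if (K < k)%N then N K else 0) <= \sum_(K < k) N K.
Proof.
move=> N0; rewrite (big_ord_widen _ _ (leq_addl m k)) [leRHS]big_mkcond /=.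
rewrite big_split_ord /= lerDl sumr_ge0 // => K _.
by case: ifP.
Qed.

(** With y < r < y + e, boundedness at 1/r gives N K <= M r^K, and the constant M is eventually
    absorbed by ((y+e)/r)^K. *)
Lemma limn_esup_root_le N y : (forall K, 0 <= N K) -> 0 < y ->
  (forall z, 0 < z < y^-1 -> exists M, forall K, N K * z ^+ K <= M) ->
  (limn_esup (fun K => (N K `^ K%:R^-1)%:E) <= y%:E)%E.
Proof.
move=> N0 y0 HN; apply/lee_addgt0Pr => e e0; rewrite -EFinD.
pose r := y + e / 2.
have r0 : 0 < r by rewrite /r; lra.
have [|M HM] := HN r^-1.
  by rewrite invr_gt0 r0 ltf_pV2 ?posrE // /r; lra.
have [|n Hn] := @expr_unbounded R ((y + e) / r) M.
  by rewrite ltr_pdivlMr // mul1r /r; lra.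
rewrite /limn_esup limf_esupE; apply: ge_ereal_inf.
(* Starting at [n.+1] excludes K = 0, where the exponent is the default inverse of 0. *)
exists (ereal_sup [set (N K `^ K%:R^-1)%:E | K in [set K | (n.+1 <= K)%N]]%classic).
  by exists [set K | (n.+1 <= K)%N]%classic => //; exact: nbhs_infty_ge.
apply: ge_ereal_sup => _ [K /= nK <-]; rewrite lee_fin.
rewrite root_powR_le ?(leq_trans _ nK) //; last by lra.
have := le_trans (HM K) (Hn K (ltnW nK)).
by rewrite expr_div_n exprVn ler_pM2r // invr_gt0 exprn_gt0.
Qed.

(** If a tail supremum s were below y, then for s < r < y the partial sums at 1/r would be bounded
    by a finite head plus a geometric series of ratio s/r. *)
Lemma limn_esup_root_ge N y : (forall K, 0 <= N K) -> 0 < y ->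
  (forall z, y^-1 < z -> forall M, exists B, M < \sum_(K < B) N K * z ^+ K) ->
  (y%:E <= limn_esup (fun K => (N K `^ K%:R^-1)%:E))%E.
Proof.
move=> N0 y0 HN; rewrite /limn_esup limf_esupE; apply: le_ereal_inf_tmp.
move=> _ [V [n _ nV] <-]; rewrite leNgt; apply/negP.
set S := ereal_sup _ => Sy.
have S_ge K : (n <= K)%N -> ((N K `^ K%:R^-1)%:E <= S)%E.
  by move=> nK; apply: ereal_sup_ubound; exists K => //; exact: nV.
have S0 : (0 <= S)%E by apply: le_trans (S_ge n (leqnn n)); rewrite lee_fin powR_ge0.
case: S S0 Sy S_ge => [s| |] //; rewrite lee_fin lte_fin => s0 sy S_ge.
pose r := (s + y) / 2.
have r0 : 0 < r by rewrite /r; lra.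
have sr : s / r < 1 by rewrite ltr_pdivrMr // mul1r /r; lra.
have [|B] := HN r^-1 _ (\sum_(K < n.+1) N K * r^-1 ^+ K + (1 - s / r)^-1).
  by rewrite ltf_pV2 ?posrE // /r; lra.
apply/negP; rewrite -leNgt.
have term0 K : 0 <= N K * r^-1 ^+ K by rewrite mulr_ge0 // exprn_ge0 // invr_ge0 ltW.
have q0 : 0 <= s / r by rewrite divr_ge0 // ltW.
apply: le_trans (lerD (lexx _) (geometric_sum_le B q0 sr)).
apply: le_trans (_ : \sum_(K < B) ((if (K < n.+1)%N then N K * r^-1 ^+ K else 0)
   + (s / r) ^+ K) <= _).
  apply: ler_sum => K _; case: ifP => [_|/negbT]; first by rewrite lerDl exprn_ge0.
  rewrite -leqNgt add0r => nK; rewrite expr_div_n exprVn ler_wpM2r //.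
    by rewrite invr_ge0 exprn_ge0 // ltW.
  have K0 : (0 < K)%N by exact: leq_trans nK.
  by rewrite -root_powR_le // -lee_fin; apply: S_ge; exact: ltnW.
rewrite big_split lerD2r /=.
exact: (@ler_sum_restrict (fun K => N K * r^-1 ^+ K)).
Qed.

End GrowthRate.

(** * The critical point of the sphere series *)

Section FreeInverseMonoid.
(** Here p is [n.+1], [w] is the critical z and [c] is C(w^2); [slope] says that lengthening the
    trunk by one edge multiplies the weight by 1 at [w]. *)
Variables (R : realType) (X : finType) (n : nat) (w c : R).
Local Open Scope ring_scope.
Hypothesis cardX : (2 * #|X|)%N = n.+2.
Hypothesis w0 : 0 < w.
Hypothesis w1 : w < 1.
Hypothesis c1 : 1 <= c.
Hypothesis cfix : 1 + w ^+ 2 * c ^+ n.+1 = c.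
Hypothesis slope : n.+1%:R * w * c ^+ n = 1.
Implicit Types (z : R) (h m : nat).

Let N K : R := (fim_sphere_card X K)%:R.

(** Truncated weights at z are at most [c], and by [slope] the trunk ratio p z c^(p-1) equals z/w.
    The two summands of the constant serve m = 0 and m >= 1; in the latter, z = w (z/w) supplies the
    remaining power. *)
Lemma weight_canon_le z h m : 0 < z -> z <= w ->
  weight z (canon_words h m (@None (letter X))) <=
    (c ^+ n.+2 + n.+2%:R * w * c ^+ n.+1 * c ^+ n.+1) * (z / w) ^+ m.
Proof.
move=> z0 zw; have c0 : 0 <= c by exact: le_trans c1.
have tc : tree_weight n.+1 z h <= c.
  apply: le_trans (tree_weight_le _ _ (ltW z0) zw) _.
  by apply: tree_weight_bound => //; rewrite cfix.
have t0 : 0 <= tree_weight n.+1 z h by exact: le_trans (tree_weight_ge1 _ _ _).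
have tX k : tree_weight n.+1 z h ^+ k <= c ^+ k by rewrite lerXn2r.
have A0 : 0 <= n.+2%:R * w * c ^+ n.+1 * c ^+ n.+1.
  by rewrite !mulr_ge0 ?exprn_ge0 // ltW.
case: m => [|m].
  rewrite weight_canon_None0 cardX mulr1; apply: le_trans (tX _) _.
  by rewrite lerDl.
rewrite weight_canon_NoneS cardX /= [(z / w) ^+ m.+1]exprS.
have ratio : n.+1%:R * z * tree_weight n.+1 z h ^+ n <= z / w.
  have -> : z / w = n.+1%:R * z * c ^+ n.
    transitivity (n.+1%:R * w * c ^+ n * (z / w)); first by rewrite slope mul1r.
    by field; rewrite gt_eqF.
  by rewrite ler_wpM2l // mulr_ge0 // ltW.
have q0 : 0 <= z / w by rewrite divr_ge0 // ltW.
apply: le_trans (_ : (n.+2%:R * w * c ^+ n.+1 * c ^+ n.+1) *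
   (z / w * (z / w) ^+ m) <= _); last first.
  apply: ler_wpM2r; last by rewrite lerDr exprn_ge0.
  by rewrite -exprS exprn_ge0.
have -> : n.+2%:R * w * c ^+ n.+1 * c ^+ n.+1 * (z / w * (z / w) ^+ m) =
  n.+2%:R * z * c ^+ n.+1 * (c ^+ n.+1 * (z / w) ^+ m).
  by field; rewrite gt_eqF.
have r0 : 0 <= n.+1%:R * z * tree_weight n.+1 z h ^+ n.
  by rewrite !mulr_ge0 ?exprn_ge0 // ltW.
have z0' := ltW z0.
apply: ler_pM; rewrite ?mulr_ge0 ?exprn_ge0 //.
  by rewrite ler_wpM2l ?mulr_ge0.
by rewrite ler_pM ?exprn_ge0 // lerXn2r.
Qed.

(** The bound on canonical weights is independent of the height, so the height bound may grow with
    K. *)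
Lemma sphere_series_bounded z : 0 < z < w -> exists M, forall K, N K * z ^+ K <= M.
Proof.
move=> /andP [z0 zw].
pose A := c ^+ n.+2 + n.+2%:R * w * c ^+ n.+1 * c ^+ n.+1.
exists (A * (1 - z / w)^-1) => K.
apply: le_trans (fim_sphere_card_upper _ _ (ltW z0)) _.
have c0 : 0 <= c by exact: le_trans c1.
apply: le_trans (_ : \sum_(m < K.+1) A * (z / w) ^+ m <= _).
  by apply: ler_sum => m _; exact: weight_canon_le (ltW zw).
rewrite -big_distrr /= ler_wpM2l //.
  by rewrite addr_ge0 ?exprn_ge0 // !mulr_ge0 ?exprn_ge0 // ltW.
apply: geometric_sum_le; first by rewrite divr_ge0 // ltW.
by rewrite ltr_pdivrMr // mul1r.
Qed.

(** Monotonicity in z reduces to bushes weighed at [w], which are at least c (1 - w^h); the ratio is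
    then at least (z/w)(1 - n w^h). *)
Lemma tree_weight_slope z : w < z ->
  exists h, 1 < n.+1%:R * z * tree_weight n.+1 z h ^+ n.
Proof.
move=> wz; have c0 : 0 < c by exact: lt_le_trans c1.
have z0 : 0 < z by exact: lt_trans wz.
have d0 : 0 < 1 - w / z by rewrite subr_gt0 ltr_pdivrMr // mul1r.
(* The height makes (n+1) w^h <= 1 - w/z; using n+1 rather than n leaves room for the strict
   inequality. *)
have [|h Hh] := @expr_unbounded R w^-1 ((n%:R + 1) / (1 - w / z)).
  by rewrite invf_gt1.
exists h; have {Hh} := Hh h (leqnn h).
rewrite exprVn ler_pdivrMr // => Hh.
have e0 : 0 < w ^+ h by rewrite exprn_gt0.
have small : (n%:R + 1) * w ^+ h <= 1 - w / z.
  by rewrite -ler_pdivlMr // mulrC.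
have e1 : w ^+ h <= 1 by rewrite exprn_ile1 // ltW.
have tc : c * (1 - w ^+ h) <= tree_weight n.+1 z h.
  apply: le_trans (tree_weight_le _ _ (ltW w0) (ltW wz)).
  by have := tree_weight_cvg h (ltW w0) c1 cfix slope; lra.
apply: lt_le_trans (_ : n.+1%:R * z * (c * (1 - w ^+ h)) ^+ n <= _); last first.
  rewrite ler_wpM2l ?mulr_ge0 ?(ltW z0) // lerXn2r // nnegrE.
    by rewrite mulr_ge0 ?subr_ge0 // ltW.
  exact: le_trans (tree_weight_ge1 _ _ _).
have -> : n.+1%:R * z * (c * (1 - w ^+ h)) ^+ n = z / w * (1 - w ^+ h) ^+ n.
  transitivity (n.+1%:R * w * c ^+ n * (z / w) * (1 - w ^+ h) ^+ n).
    by rewrite exprMn; field; rewrite gt_eqF.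
  by rewrite slope mul1r.
apply: lt_le_trans (_ : z / w * (1 + n%:R * (- w ^+ h)) <= _); last first.
  apply: ler_wpM2l; first by rewrite divr_ge0 // ltW.
  apply: bernoulli_ineq.
  by rewrite lerN2.
have zwz : z / w * (w / z) = 1 by field; rewrite !gt_eqF.
rewrite -[ltLHS]zwz.
rewrite ltr_pM2l ?divr_gt0 //; lra.
Qed.

(** With the height fixed so that the trunk ratio exceeds 1, the words of one sufficiently long
    trunk length already weigh more than [M]. *)
Lemma sphere_series_unbounded z M : w < z -> exists B, M < \sum_(K < B) N K * z ^+ K.
Proof.
move=> wz; have z0 : 0 < z by exact: lt_trans wz.
have [h Hh] := tree_weight_slope wz.
have [m Hm] := expr_unbounded ((M + 1) / z) Hh.
have [B HB] := fim_sphere_card_lower X h m.+1 (ltW z0).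
exists B; apply: lt_le_trans HB; rewrite weight_canon_NoneS cardX /=.
have t1 := tree_weight_ge1 n.+1 z h.
set t := tree_weight _ _ _ in Hh Hm t1 *.
have tX : 1 <= t ^+ n.+1 by rewrite exprn_ege1.
have := Hm m (leqnn m); rewrite ler_pdivrMr //.
set r := (_ ^+ m) => Mr.
have r0 : 0 <= r by rewrite exprn_ge0 // ltW // (lt_trans _ Hh).
apply: lt_le_trans (_ : r * z <= _); first by lra.
have -> : n.+2%:R * z * t ^+ n.+1 * (t ^+ n.+1 * r) =
   (r * z) * (n.+2%:R * (t ^+ n.+1 * t ^+ n.+1)) by ring.
rewrite ler_peMr ?mulr_ge0 ?(ltW z0) //.
by rewrite mulr_ege1 ?ler1n // mulr_ege1.
Qed.

Lemma fim_growth_rate_eq : fim_growth_rate R X = w^-1%:E.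
Proof.
have y0 : 0 < w^-1 by rewrite invr_gt0.
have N0 K : 0 <= N K by rewrite ler0n.
apply/eqP; rewrite eq_le; apply/andP; split.
  apply: (limn_esup_root_le (N := N)) => // z; rewrite invrK; exact: sphere_series_bounded.
apply: (limn_esup_root_ge (N := N)) => // z; rewrite invrK => wz M.
exact: sphere_series_unbounded.
Qed.

End FreeInverseMonoid.

(** * The growth rate as root of the equation *)

Local Open Scope ring_scope.

Theorem mainTheorem11 (R : realType) (X : finType) (hX : (2 <= #|X|)%N) :
  let p := (2 * #|X|).-1 in
  exists y : R,
    fim_growth_rate R X = y%:E /\
    (p%:R ^+ p * y ^+ (p - 2) - (p%:R * y - 1) ^+ (p - 1) = 0) /\
    (forall z : R, p%:R ^+ p * z ^+ (p - 2) - (p%:R * z - 1) ^+ (p - 1) = 0 -> z <= y) /\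
    p%:R < y < p%:R + 1.
Proof.
move=> p; have [q pq q0] : exists2 q, p = q.+2 & (0 < q)%N.
  by exists (p - 2)%N; rewrite /p; lia.
have cardX : (2 * #|X|)%N = q.+3 by move: pq; rewrite /p; lia.
rewrite {}pq !subSS !subn0 {p}.
have [y [yI Ey maxy]] := growth_equation_root R q0.
have P3 : (3 : R) <= q.+2%:R by rewrite ler_nat.
set P : R := q.+2%:R in yI Ey maxy P3 *.
have y3 : 3 < y by case/andP: yI => yP _; lra.
have a0 : 0 < P * y - 1 by nra.
have y0 : 0 < y by lra.
have P0 : 0 < P by lra.
exists y; split; last first.
  split; first by rewrite Ey subrr.
  by split=> // z /eqP; rewrite subr_eq0 => /eqP; exact: maxy.
have nz : [/\ y != 0, P != 0 & P * y - 1 != 0] by rewrite !gt_eqF.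
case: nz => yn Pn an.
(* With w = 1/y, the slope condition turns c = 1 + w^2 c^p into c = 1 + w c / p, whose solution is
   this value. *)
pose c := P * y / (P * y - 1).
(* For this [c] the slope condition is precisely the polynomial equation for [y]. *)
have cX : P * c ^+ q.+1 = y.
  rewrite expr_div_n -Ey exprMn !exprSr; field.
  by rewrite -natrD; apply/and3P; split => //; exact: expf_neq0.
rewrite -[y in RHS]invrK; apply: (fim_growth_rate_eq (c := c) cardX).
- by rewrite invr_gt0.
- by rewrite invf_lt1 //; lra.
- by rewrite /c ler_pdivlMr // mul1r; lra.
- have -> : y^-1 ^+ 2 * c ^+ q.+2 = y^-1 ^+ 2 * (c / P) * (P * c ^+ q.+1).
    by rewrite [c ^+ q.+2]exprS; field; rewrite -?natrD yn Pn.
  by rewrite cX /c; field; rewrite -?natrD yn Pn an.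
- by rewrite mulrAC cX divff.
Qed.
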